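(* For every integer $\Delta\ge1$ and every $\varepsilon\in(0,1/2)$ there exists a non-decreasing continuous function $F^{(\varepsilon)}_{\Delta}:\mathbb{R}\to\mathbb{R}$ with $F^{(\varepsilon)}_{\Delta}(z)=0$ for $z\le0$ and $F^{(\varepsilon)}_{\Delta}(z)=1$ for $z\ge1$ such that $$\lim_{n\to\infty}\ \sup_{\mathbf{x}}\ \sup_{z\in[0,1]}\big|F^{(\varepsilon)}_{n,\Delta}(z\,|\,\mathbf{x})-F^{(\varepsilon)}_{\Delta}(z)\big|=0,$$ where $\sup_{\mathbf{x}}$ is over all boundary conditions $\mathbf{x}\in[0,1]^{\partial\mathbb{T}_{n,\Delta}}$.
   Context: For integers $\Delta\ge1$, $n\ge0$, $\mathbb{T}_{n,\Delta}$ is the rooted tree of depth $n$ in which every node at distance less than $n$ from the root has exactly $\Delta$ children; its leaf set $\partial\mathbb{T}_{n,\Delta}$ is the set of nodes at distance $n$ from the root. For a finite simple graph $\mathbb{G}=(V,E)$ let $\mathcal{P}(\mathbb{G})=\{\mathbf{x}\in\mathbb{R}^V: x_u\ge0\ \forall u,\ x_u+x_v\le1\ \forall (u,v)\in E\}$. For a finite Borel measure $\mu$ on $[0,1]$ the hardcore model on $\mathbb{G}$ with free spin measure $\mu$ is $\mathbb{P}_{\mathbb{G},\mu}(A)=\mu^{\otimes V}(A)/\mu^{\otimes V}(\mathcal{P}(\mathbb{G}))$, $A\subset\mathcal{P}(\mathbb{G})$ Borel. The $\varepsilon$-continuous hardcore model with activity $1$ has free spin measure $$\nu^\varepsilon_1(B)=\frac1{2\varepsilon}\int_B\big(\mathbb{I}_{[0,\varepsilon]}(x)+\mathbb{I}_{[1-\varepsilon,1]}(x)\big)\,dx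 .$$ $F^{(\varepsilon)}_{n,\Delta}(\cdot\,|\,\mathbf{x})$ is the cumulative distribution function of the spin at the root of $\mathbb{T}_{n,\Delta}$ under $\mathbb{P}_{\mathbb{T}_{n,\Delta},\nu_1^\varepsilon}$, conditioned on the leaf spins being $\mathbf{x}\in[0,1]^{\partial\mathbb{T}_{n,\Delta}}$. Explicitly, with $\mu=\nu^\varepsilon_1$, $z\in[0,1]$: for $n=1$ and $\bar x=\max_i x_i$, $F_1(z|\mathbf{x})=\mu[0,\min(z,1-\bar x)]/\mu[0,1-\bar x]$ if $\bar x<1$, and $F_1(z|\mathbf{x})=1$ if $\bar x=1$ (the root is forced to be $0$); for $n\ge2$, $F_n(z|\mathbf{x})=\int_{[0,z]}\prod_{i=1}^\Delta F_{n-1}(1-t|\mathbf{x}^i)\mu(dt)\big/\int_{[0,1]}\prod_{i=1}^\Delta F_{n-1}(1-t|\mathbf{x}^i)\mu(dt)$, where $\mathbf{x}^i$ is the restriction of $\mathbf{x}$ to the leaves of the subtree rooted at the $i$-th child of the root. *)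

(* Defs.v *)
From HB Require Import structures.
From mathcomp Require Import all_boot all_order all_algebra.
From mathcomp Require Import all_classical all_reals all_analysis.
From mathcomp Require Import measurable_realfun.
Set Implicit Arguments.
Unset Strict Implicit.
Unset Printing Implicit Defensive.
Import Order.TTheory GRing.Theory Num.Theory.
Import numFieldNormedType.Exports.
Local Open Scope classical_set_scope.
Local Open Scope ring_scope.

Section FreeSpinMeasure.
Context {R : realType} (eps : R).
Local Notation leb := (@lebesgue_measure R).

Definition spin_density (x : R) : R :=
  (2 * eps)^-1 * (\1_(`[0, eps]) x + \1_(`[1 - eps, 1]) x).

(* No hypothesis on [eps] is needed: if [eps <= 0] the density is zero, the
   intervals being empty (or, for [eps = 0], the coefficient being 0). *)
Lemma spin_density_ge0 x : 0 <= spin_density x.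
Proof.
rewrite /spin_density; have [e0|e0] := leP 0 eps.
  by apply: mulr_ge0; [rewrite invr_ge0 mulr_ge0|rewrite addr_ge0// indicE].
rewrite !set_itv_ge ?indic0 ?addr0 ?mulr0// bnd_simp -ltNge//.
by rewrite ltrDl oppr_gt0.
Qed.

Lemma measurable_spin_density : measurable_fun setT spin_density.
Proof.
apply: measurable_funM => //; apply: measurable_funD; exact: measurable_indic.
Qed.

Definition free_spin (B : set (measurableTypeR R)) : \bar R :=
  (\int[leb]_(x in B) (spin_density x)%:E)%E.

Let free_spin0 : free_spin set0 = 0%E.
Proof. by rewrite /free_spin integral_set0. Qed.

Let free_spin_ge0 B : (0 <= free_spin B)%E.
Proof. by apply: integral_ge0 => x _; rewrite lee_fin spin_density_ge0. Qed.

Let free_spin_sigma_additive : semi_sigma_additive free_spin.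
Proof.
move=> /= F mF tF mUF; rewrite /free_spin; apply: cvg_toP.
  apply: ereal_nondecreasing_is_cvgn => m n mn.
  apply: lee_sum_nneg_natr => // k _ _; exact: free_spin_ge0.
rewrite ge0_integral_bigcup//=.
- apply: measurable_funTS; apply: measurableT_comp => //.
  exact: measurable_spin_density.
- by move=> x _; rewrite lee_fin spin_density_ge0.
Qed.

HB.instance Definition _ := isMeasure.Build _ _ _ free_spin
  free_spin0 free_spin_ge0 free_spin_sigma_additive.

End FreeSpinMeasure.

(* A leaf of the [D]-ary tree of depth [n] is the word of the [n] child indices
   met on the path from the root; the head of the word is the root's child. *)
Definition leaf (D n : nat) : Type := n.-tuple 'I_D.

Section RootCdf.
Context {R : realType} (D : nat).
Variable mu : {measure set (measurableTypeR R) -> \bar R}.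

Definition boundary (n : nat) : set (leaf D n -> R) :=
  [set x | forall l, 0 <= x l <= 1].

Definition sub_boundary (n : nat) (x : leaf D n.+1 -> R) (i : 'I_D) :
    leaf D n -> R :=
  fun l => x (cons_tuple i l).

(* The neutral element 0 of the maximum is harmless: spins are nonnegative. *)
Definition max_spin (n : nat) (x : leaf D n -> R) : R :=
  \big[Num.max/0]_(l : n.-tuple 'I_D) x l.

Definition root_cdf1 (x : leaf D 1 -> R) (z : R) : R :=
  let xbar := max_spin x in
  if xbar < 1 then
    fine (mu `[0, Num.min z (1 - xbar)]%classic) /
    fine (mu `[0, 1 - xbar]%classic)
  else 1.

(* Given a root spin [t], the spins of the [D] subtrees are independent, and the
   hard-core constraint asks that the spin of each child is at most [1 - t]. *)
Definition root_cdf_step (n : nat) (F : (leaf D n -> R) -> R -> R)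
    (x : leaf D n.+1 -> R) (z : R) : R :=
  let weight t := \prod_(i < D) F (sub_boundary x i) (1 - t) in
  (\int[mu]_(t in `[0, z]) weight t) / (\int[mu]_(t in `[0, 1]) weight t).

(* Depth 1 is the base case, and not the general step applied to depth 0: if a
   leaf spin is 1 then the root is forced to be 0, which is a null event. *)
Fixpoint root_cdf_succ (m : nat) : (leaf D m.+1 -> R) -> R -> R :=
  match m with
  | 0 => root_cdf1
  | k.+1 => root_cdf_step (@root_cdf_succ k)
  end.

(* The value at [z] in [0, 1] of the conditional CDF of the root spin given the
   leaf spins [x], for [n >= 1].  For [n = 0], where the root is the only leaf,
   it is set to the CDF of the Dirac mass at the leaf spin. *)
Definition root_cdf (n : nat) : (leaf D n -> R) -> R -> R :=
  match n with
  | 0 => fun x z => (x [tuple] <= z)%R%:R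
  | m.+1 => @root_cdf_succ m
  end.

End RootCdf.

(* Main.v *)
Require Import Defs.
From HB Require Import structures.
From mathcomp Require Import all_boot all_order all_algebra.
From mathcomp Require Import all_classical all_reals all_analysis.
From mathcomp Require Import measurable_realfun ring lra.
Set Implicit Arguments.
Unset Strict Implicit.
Unset Printing Implicit Defensive.
Import Order.TTheory GRing.Theory Num.Theory.
Import numFieldNormedType.Exports.
Local Open Scope classical_set_scope.
Local Open Scope ring_scope.

(** Write [m z] for the free spin mass of [[0, z]].  One level of the recursion
    sends the root CDFs [F_i] of the subtrees to the primitive
    [z |-> \int_[0, z] \prod_i F_i (1 - t) mu(dt)], divided by its value at [1].
    Two ideas give the theorem.

    _Monotonicity_.  Order distribution functions by the reverse hazard rate
    order: [F] is below [G] when [F / G] is nonincreasing ([rh_le]); on CDFs this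
    implies [G <= F] pointwise.  A step of the recursion reverses this order
    ([step_anti]), and the constant [1], the root spin forced to be [0], lies below
    everything.  So if [E_0 = 1] and [E_(n+1)] is the step of [E_n], the root CDF at
    depth [k + 1] lies between [E_k] and [E_(k+1)] whatever the leaf spins are
    ([root_cdf_bounds]), and pointwise
    [E_1 <= E_3 <= E_5 <= ... <= E_4 <= E_2 <= E_0].  It remains to close the gap
    between the odd and the even terms.  These are primitives of ordered functions
    divided by normalizers [Z_n = \int_[0, 1] E_n (1 - t) ^ D mu(dt)], so the gap is
    controlled uniformly in [z] by [Z_(2k) - Z_(2k+1)] ([step_diff_le]).

    _A conserved quantity_.  Let [B] be the step of [A] and [C] the step of [B].
    Since [mu] has no atom and is invariant under [t |-> 1 - t],
    [d (Z_A B(z) ^ (D+1) + Z_B C(1-z) ^ (D+1))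
       = (D+1) B(z) ^ D (A(1-z) ^ D - C(1-z) ^ D) mu(dz)].
    The bracket on the left goes from [Z_B] to [Z_A] between [0] and [1].  For a point of
    period two of the recursion, [A = C], it is constant, so that [Z_A = Z_B]: this
    is the reason for uniqueness.  In general, if [C <= A], the right-hand side has
    total mass at most [(D+1) (Z_A - Z_C)], and
    [Z_A - Z_B <= (D+1) (Z_A - Z_C)] ([normalizer_contraction]).  With
    [A = E_(2k)] and the interlacing [Z_(2k+1) <= Z_(2k+3)], this
    makes [Z_(2k) - Z_(2k+1)] decrease geometrically with ratio [D / (D+1)]
    ([normalizer_gap]).  Hence the convergence is exponentially fast, and the limit
    is Lipschitz because all the [E_n] with [n >= 1] are, with a common constant. *)

(** * Real inequalities *)

Section RealInequalities.
Context {R : realType}.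
Implicit Types x y : R.

Lemma subrX_le n x y : 0 <= x -> x <= y ->
  y ^+ n.+1 - x ^+ n.+1 <= n.+1%:R * y ^+ n * (y - x).
Proof.
move=> x0 xy; elim: n => [|n IH]; first by rewrite !expr1 expr0 !mul1r.
have y0 : 0 <= y by exact: le_trans xy.
have xyn : x ^+ n.+1 <= y ^+ n.+1 by rewrite lerXn2r ?nnegrE.
have := ler_wpM2l y0 IH; have := ler_wpM2r (_ : 0 <= y - x) xyn.
rewrite subr_ge0 => /(_ xy); rewrite (exprS y n.+1) (exprS x n.+1).
rewrite [n.+2%:R]mulrS (exprS y n); move: (y ^+ n) (x ^+ n.+1) (n.+1%:R) => a b c.
lra.
Qed.

Lemma subrX_ge n x y : 0 <= x -> x <= y ->
  n.+1%:R * x ^+ n * (y - x) <= y ^+ n.+1 - x ^+ n.+1.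
Proof.
move=> x0 xy; elim: n => [|n IH]; first by rewrite !expr1 expr0 !mul1r.
have xyn : x ^+ n.+1 <= y ^+ n.+1 by rewrite lerXn2r ?nnegrE//; exact: le_trans xy.
have := ler_wpM2l x0 IH; have := ler_wpM2r (_ : 0 <= y - x) xyn.
rewrite subr_ge0 => /(_ xy); rewrite (exprS y n.+1) (exprS x n.+1).
rewrite [n.+2%:R]mulrS (exprS x n); move: (x ^+ n) (y ^+ n.+1) (n.+1%:R) => a b c.
lra.
Qed.

Lemma subrX_le_nat n x y : 0 <= x -> x <= y -> y <= 1 ->
  y ^+ n - x ^+ n <= n%:R * (y - x).
Proof.
move=> x0 xy y1; case: n => [|n]; first by rewrite !expr0 subrr mul0r.
apply: le_trans (subrX_le n x0 xy) _.
rewrite ler_wpM2r ?subr_ge0// ler_piMr// exprn_ile1//; exact: le_trans xy.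
Qed.

(** A function whose increments are at most quadratic in the step cannot
    increase: cutting [[0, 1]] into [N] pieces leaves at most [C / N].  This
    replaces differentiating the conserved quantity, whose two terms are not
    differentiable where the free spin density jumps. *)
Lemma quadratic_increment_le (f : R -> R) (C : R) :
  (forall y z, 0 <= y -> y <= z -> z <= 1 -> f z - f y <= C * (z - y) ^+ 2) ->
  f 1 <= f 0.
Proof.
move=> fC; apply/ler_addgt0Pr => e e0.
have C0 : 0 <= Num.max C 0 by rewrite le_max lexx orbT.
pose N := (Num.bound (Num.max C 0 / e)).+1.
have N0 : 0 < N%:R :> R by rewrite ltr0n.
have CN : Num.max C 0 <= e * N%:R.
  rewrite mulrC -ler_pdivrMr//; apply/ltW.
  have := @archi_boundP R (Num.max C 0 / e).
  rewrite divr_ge0 ?(ltW e0)// => /(_ isT) /lt_le_trans; apply.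
  by rewrite ler_nat.
have : f 1 - f 0 = \sum_(0 <= i < N) (f (i.+1%:R / N%:R) - f (i%:R / N%:R)).
  by rewrite telescope_sumr// mul0r divff// gt_eqF.
move=> E; rewrite -lerBlDl E.
apply: (@le_trans _ _ (\sum_(0 <= i < N) (e / N%:R))); last first.
  by rewrite sumr_const_nat subn0 -[_ / _ *+ _]mulr_natr mulfVK// gt_eqF.
rewrite big_nat [leRHS]big_nat; apply: ler_sum => i /andP[_ iN].
apply: le_trans (fC _ _ _ _ _) _.
- by rewrite divr_ge0.
- by rewrite ler_pM2r ?invr_gt0// ler_nat.
- by rewrite ler_pdivrMr// mul1r ler_nat.
have -> : i.+1%:R / N%:R - i%:R / N%:R = N%:R^-1 :> R.
  by rewrite -mulrBl -natrB// subSnn mul1r.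
apply: (@le_trans _ _ (Num.max C 0 * N%:R^-1 ^+ 2)).
  by rewrite ler_wpM2r ?exprn_ge0 ?invr_ge0 ?ler0n// le_max lexx.
rewrite expr2 mulrA ler_wpM2r ?invr_ge0 ?ler0n//.
by rewrite ler_pdivrMr.
Qed.

End RealInequalities.

(** * Primitives with respect to the free spin measure *)

Section Primitive.
Context {R : realType} (mu : {measure set (measurableTypeR R) -> \bar R}).
Implicit Types (f g w : R -> R) (s t y z : R).

Definition primitive f z : R := \int[mu]_(t in `[0, z]) f t.

Definition spin_cdf z : R := fine (mu `[0, z]%classic).

Local Notation intT f := (mu.-integrable setT (EFin \o f)).

Lemma integrable_itv f (i : interval R) : intT f ->
  mu.-integrable [set` i] (EFin \o f).
Proof. by move=> fi; apply: integrableS fi => //; exact: measurable_itv. Qed.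

Lemma primitive_lt0 f z : z < 0 -> primitive f z = 0.
Proof. by move=> z0; rewrite /primitive set_itv_ge ?Rintegral_set0// bnd_simp -ltNge. Qed.

Lemma primitive_cst c z : primitive (fun=> c) z = c * spin_cdf z.
Proof. by rewrite /primitive Rintegral_cst. Qed.

Lemma spin_cdfE z : spin_cdf z = primitive (fun=> 1) z.
Proof. by rewrite primitive_cst mul1r. Qed.

Lemma primitiveZr f c z : intT f ->
  primitive (fun t => f t * c) z = primitive f z * c.
Proof. by move=> fi; rewrite /primitive RintegralZr//; exact: integrable_itv. Qed.

Lemma primitive_split f y z : intT f -> 0 <= y -> y <= z ->
  primitive f z - primitive f y = \int[mu]_(t in `]y, z]) f t.
Proof.
move=> fi y0 yz; rewrite /primitive.
have -> : `[0, z]%classic = `[0, y]%classic `|` `]y, z]%classic :> set R.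
  by rewrite -itv_bndbnd_setU// bnd_simp.
rewrite Rintegral_setU//.
- by rewrite addrC addKr.
- by apply: integrableS fi => //; apply: measurableU; exact: measurable_itv.
- rewrite disj_set2E; apply/eqP/seteqP; split => // x /=.
  rewrite !in_itv/= => -[/andP[_ xy] /andP[yx _]].
  by move: (lt_le_trans yx xy); rewrite ltxx.
Qed.

Lemma le_primitive f g z : intT f -> intT g ->
  (forall t, 0 <= t -> t <= z -> f t <= g t) -> primitive f z <= primitive g z.
Proof.
move=> fi gi fg; apply: le_Rintegral => //; try exact: integrable_itv.
by move=> x /=; rewrite in_itv/= => /andP[]; exact: fg.
Qed.

Lemma le_primitive_increment f g y z : intT f -> intT g -> y <= z ->
  (forall t, y <= t -> t <= z -> f t <= g t) ->
  primitive f z - primitive f y <= primitive g z - primitive g y.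
Proof.
move=> fi gi yz fg; have [y0|y0] := leP 0 y.
  rewrite !primitive_split//; apply: le_Rintegral => //; try exact: integrable_itv.
  by move=> x /=; rewrite in_itv/= => /andP[/ltW yx xz]; exact: fg.
rewrite !(primitive_lt0 _ y0) !subr0; apply: le_primitive => // t t0 tz.
by apply: fg => //; apply: le_trans t0; exact: ltW.
Qed.

(** A likelihood ratio inequality between two densities passes to their
    primitives: split [[0, t]] at [s], integrate the pointwise inequality in [u]
    over [[0, s]], then in [v] over [(s, t]]. *)
Lemma primitive_cross f g s t : intT f -> intT g ->
  (forall u v, u <= v -> f u * g v <= f v * g u) -> s <= t ->
  primitive g t * primitive f s <= primitive g s * primitive f t.
Proof.
move=> fi gi fg st.
have Zi h c : intT h -> intT (fun v => h v * c).
  by move=> hi; have := integrableZr measurableT c hi; apply: eq_integrable.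
have := @le_primitive_increment (fun v => g v * primitive f s)
  (fun v => f v * primitive g s) s t.
rewrite !primitiveZr//; move=> /(_ (Zi _ _ gi) (Zi _ _ fi) st) H.
suff : primitive g t * primitive f s - primitive g s * primitive f s <=
  primitive f t * primitive g s - primitive f s * primitive g s by lra.
apply: H => v sv vt.
rewrite mulrC -primitiveZr// mulrC -primitiveZr//.
apply: le_primitive; try exact: Zi.
by move=> u u0 us; rewrite [leRHS]mulrC; apply: fg; exact: le_trans sv.
Qed.

End Primitive.

(** * Symmetric Lipschitz spin measures *)

Section SymmetricSpin.
Context {R : realType} (mu : {measure set (measurableTypeR R) -> \bar R}).
Context (D : nat) (K : R).
Implicit Types (w : R -> R) (z : R).

Local Notation m := (spin_cdf mu).
Local Notation P := (primitive mu).
Local Notation intT f := (mu.-integrable setT (EFin \o f)).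

(** The Lipschitz bound excludes atoms, with a linear modulus of continuity.
    The symmetry is that of activity one: the spins [t] and [1 - t] have the same
    weight. *)
Record symmetric_spin : Prop := SymmetricSpin {
  spin_mass_le1 : (mu setT <= 1)%E;
  spin_cdf_0 : m 0 = 0;
  spin_cdf_lipschitz : forall y z, y <= z -> m z - m y <= K * (z - y);
  spin_cdf_sym : forall z, 0 <= z -> z <= 1 -> m (1 - z) = 1 - m z;
  spin_cdf_gt0 : forall z, 0 < z -> 0 < m z }.

Hypothesis mu_spin : symmetric_spin.

(** The integrands of the recursion.  Monotonicity makes them measurable, and
    bounds their integrals over an interval by their values at its endpoints. *)
Record weight w : Prop := Weight {
  weight_anti : {homo w : s t /~ s <= t};
  weight_ge0 : forall t, 0 <= w t;
  weight_le1 : forall t, w t <= 1 }.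

Lemma bounded_integrable (f : R -> R) : measurable_fun setT f ->
  (forall t, 0 <= f t) -> (forall t, f t <= 1) -> intT f.
Proof.
move=> mf f0 f1; apply: measurable_bounded_integrable => //.
  exact: le_lt_trans (spin_mass_le1 mu_spin) (ltry _).
exists 1; split => // x x1 t _ /=; rewrite ger0_norm//.
by apply: le_trans (f1 _) _; exact: ltW.
Qed.

Lemma weight_integrable w : weight w -> intT w.
Proof.
move=> [wa w0 w1]; apply: bounded_integrable => //.
apply: nonincreasing_measurable => //; by move=> s t st; exact: wa.
Qed.

Lemma cst_weight c : 0 <= c -> c <= 1 -> weight (fun=> c).
Proof. by move=> c0 c1; split. Qed.

Lemma primitive_increment_ge w y z : weight w -> y <= z ->
  w z * (m z - m y) <= P w z - P w y.
Proof.
move=> ww yz; rewrite mulrBr -!primitive_cst.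
apply: le_primitive_increment => //; first 2 last.
- by move=> t _ tz; exact: weight_anti.
- by apply: weight_integrable; apply: cst_weight; [exact: weight_ge0|exact: weight_le1].
- exact: weight_integrable.
Qed.

Lemma primitive_increment_le w y z : weight w -> y <= z ->
  P w z - P w y <= w y * (m z - m y).
Proof.
move=> ww yz; rewrite mulrBr -!primitive_cst.
apply: le_primitive_increment => //; first 2 last.
- by move=> t yt _; exact: weight_anti.
- exact: weight_integrable.
- by apply: weight_integrable; apply: cst_weight; [exact: weight_ge0|exact: weight_le1].
Qed.

Lemma spin_cdf_homo : {homo m : y z / y <= z}.
Proof.
move=> y z yz; rewrite !spin_cdfE -subr_ge0.
have i1 := weight_integrable (cst_weight ler01 (lexx 1)).
have i0 := weight_integrable (cst_weight (lexx 0) ler01).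
have := @le_primitive_increment _ mu _ _ y z i0 i1 yz (fun _ _ _ => ler01).
by rewrite !(primitive_cst _ 0) !mul0r subrr.
Qed.

Lemma spin_cdf_1 : m 1 = 1.
Proof. by have := spin_cdf_sym mu_spin (lexx 0) ler01; rewrite subr0 (spin_cdf_0 mu_spin) subr0. Qed.

Lemma spin_cdf_le1 z : m z <= 1.
Proof.
have mT : (mu `[0%R, z]%classic <= 1)%E.
  apply: le_trans (spin_mass_le1 mu_spin).
  by apply: le_measure; rewrite ?inE//; exact: measurable_itv.
rewrite /spin_cdf -lee_fin fineK// ge0_fin_numE//.
exact: le_lt_trans mT (ltry _).
Qed.

Lemma spin_cdf_ge1 z : 1 <= z -> m z = 1.
Proof.
move=> z1; apply/eqP; rewrite eq_le spin_cdf_le1 -{1}spin_cdf_1.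
exact: spin_cdf_homo.
Qed.

Lemma spin_cdf_ge0 z : 0 <= m z.
Proof. by rewrite /spin_cdf fine_ge0. Qed.

Lemma spin_cdf_le0 z : z <= 0 -> m z = 0.
Proof.
move=> z0; apply/eqP; rewrite eq_le spin_cdf_ge0 andbT -(spin_cdf_0 mu_spin).
exact: spin_cdf_homo.
Qed.

Lemma spin_cdf_half : m 2^-1 = 2^-1.
Proof.
have := @spin_cdf_sym mu_spin 2^-1; rewrite invr_ge0 ler0n => /(_ isT).
rewrite invf_le1// ler1n => /(_ isT).
have -> : 1 - 2^-1 = 2^-1 :> R by lra.
lra.
Qed.

Lemma lipschitz_const_ge0 : 0 <= K.
Proof.
have := spin_cdf_lipschitz mu_spin ler01.
rewrite spin_cdf_1 (spin_cdf_0 mu_spin); lra.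
Qed.

Lemma primitive_homo w : weight w -> {homo P w : y z / y <= z}.
Proof.
move=> ww y z yz; rewrite -subr_ge0; apply: le_trans (primitive_increment_ge ww yz).
by apply: mulr_ge0; [exact: weight_ge0|rewrite subr_ge0 spin_cdf_homo].
Qed.

Lemma primitive_le0 w z : weight w -> z <= 0 -> P w z = 0.
Proof.
move=> ww z0; have lo : z - 1 <= z by lra.
have lt : z - 1 < 0 by lra.
have := primitive_increment_ge ww lo; have := primitive_increment_le ww lo.
rewrite (primitive_lt0 _ _ lt) !spin_cdf_le0 ?(ltW lt)// !subr0 !mulr0 => h1 h2.
by apply/eqP; rewrite eq_le h1 h2.
Qed.

Lemma primitive_ge1 w z : weight w -> 1 <= z -> P w z = P w 1.
Proof.
move=> ww z1.
have := primitive_increment_ge ww z1; have := primitive_increment_le ww z1.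
rewrite !spin_cdf_ge1// subrr !mulr0 subr_le0 subr_ge0 => h1 h2.
by apply/eqP; rewrite eq_le h1 h2.
Qed.

Lemma primitive_ge0 w z : weight w -> 0 <= P w z.
Proof.
move=> ww; have [z0|z0] := leP z 0; first by rewrite primitive_le0.
by rewrite -(primitive_le0 ww (lexx 0)); apply: primitive_homo => //; exact: ltW.
Qed.

(** * One step of the recursion reverses the reverse hazard rate order *)

Definition rh_le (F G : R -> R) := forall s t, s <= t -> F t * G s <= F s * G t.

(** Being below [spin_cdf] in the order is what bounds the normalizers away from
    [0], uniformly in the boundary condition. *)
Record admissible (F : R -> R) : Prop := Admissible {
  adm_homo : {homo F : s t / s <= t};
  adm_ge0 : forall z, 0 <= F z;
  adm_ge1 : forall z, 1 <= z -> F z = 1;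
  adm_rh_le : rh_le F m }.

Lemma rh_le_pointwise F G z : admissible F -> admissible G -> rh_le F G ->
  G z <= F z.
Proof.
move=> aF aG FG; have [z1|/ltW z1] := leP z 1.
  by have := FG _ _ z1; rewrite (adm_ge1 aF (lexx 1)) (adm_ge1 aG (lexx 1)) mul1r mulr1.
by rewrite (adm_ge1 aF)// (adm_ge1 aG).
Qed.

Lemma admissible_le1 F z : admissible F -> F z <= 1.
Proof.
move=> aF; have [z1|/ltW z1] := leP z 1; last by rewrite adm_ge1.
by rewrite -(adm_ge1 aF (lexx 1)) adm_homo.
Qed.

Lemma admissible_spin_cdf : admissible m.
Proof.
split; [exact: spin_cdf_homo|exact: spin_cdf_ge0|exact: spin_cdf_ge1|].
by move=> s t _; rewrite mulrC.
Qed.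

Lemma admissible_half F : admissible F -> 2^-1 <= F 2^-1.
Proof.
move=> aF; rewrite -{1}spin_cdf_half.
apply: rh_le_pointwise => //; [exact: admissible_spin_cdf|exact: adm_rh_le].
Qed.

Lemma admissible_cst1 : admissible (fun=> 1).
Proof.
by split => // s t st; rewrite !mul1r spin_cdf_homo.
Qed.

Definition child_weight (F : 'I_D -> R -> R) (t : R) : R := \prod_(i < D) F i (1 - t).

Definition step (F : 'I_D -> R -> R) (z : R) : R :=
  P (child_weight F) z / P (child_weight F) 1.

Lemma child_weightP F : (forall i, admissible (F i)) -> weight (child_weight F).
Proof.
move=> aF; split.
- move=> s t st; apply: ler_prod => i _; rewrite adm_ge0//= adm_homo//.
  by rewrite lerD2l lerN2.
- by move=> t; apply: prodr_ge0 => i _; exact: adm_ge0.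
- move=> t; rewrite /child_weight -[leRHS](@big1 R 1 *%R 'I_D (index_enum _) xpredT (fun=> 1))//.
  apply: ler_prod => i _; rewrite adm_ge0//=; exact: admissible_le1.
Qed.

(** Restrict to the spins below [1 / 2]: they have mass [1 / 2], and each factor
    [F i (1 - t)] is there at least [F i (1 / 2) >= m (1 / 2) = 1 / 2]. *)
Lemma normalizer_ge F : (forall i, admissible (F i)) ->
  2^-1 ^+ D.+1 <= P (child_weight F) 1.
Proof.
move=> aF; have ww := child_weightP aF.
have h0 : 0 <= 2^-1 :> R by rewrite invr_ge0.
have h1 : 2^-1 <= 1 :> R by rewrite invf_le1// ler1n.
apply: le_trans (primitive_homo ww h1).
have := primitive_increment_ge ww h0.
rewrite (primitive_le0 ww (lexx 0)) subr0 (spin_cdf_0 mu_spin) subr0 spin_cdf_half.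
apply: le_trans; rewrite exprSr ler_wpM2r// /child_weight.
rewrite -[X in _ ^+ X]card_ord -prodr_const; apply: ler_prod => i _.
rewrite h0/=; have -> : 1 - 2^-1 = 2^-1 :> R by lra.
exact: admissible_half.
Qed.

Lemma normalizer_gt0 F : (forall i, admissible (F i)) -> 0 < P (child_weight F) 1.
Proof. by move=> aF; apply: lt_le_trans (normalizer_ge aF); rewrite exprn_gt0// invr_gt0. Qed.

(** Under [t |-> 1 - t] the ratio of the integrands becomes monotone in the
    opposite direction, and [primitive_cross] transfers this to the primitives. *)
Lemma step_anti F G : (forall i, admissible (F i)) -> (forall i, admissible (G i)) ->
  (forall i, rh_le (F i) (G i)) -> rh_le (step G) (step F).
Proof.
move=> aF aG FG s t st; rewrite /step.
rewrite mulrACA [leRHS]mulrACA ler_wpM2r//.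
  by rewrite mulr_ge0// invr_ge0 ltW// normalizer_gt0.
apply: primitive_cross => //.
- by apply: weight_integrable; exact: child_weightP.
- by apply: weight_integrable; exact: child_weightP.
move=> u v uv; rewrite /child_weight -!big_split/=; apply: ler_prod => i _.
apply/andP; split; first by apply: mulr_ge0; exact: adm_ge0.
by apply: FG; rewrite lerD2l lerN2.
Qed.

Lemma step_cst1 z : step (fun _ _ => 1) z = m z.
Proof.
rewrite /step; have -> : child_weight (fun _ _ => 1) = fun=> 1.
  by apply/funext => t; rewrite /child_weight big1.
by rewrite -!spin_cdfE spin_cdf_1 divr1.
Qed.

Lemma rh_le_cst1 (F : R -> R) : {homo F : s t / s <= t} -> rh_le (fun=> 1) F.
Proof. by move=> Fh s t st; rewrite !mul1r Fh. Qed.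

Lemma admissible_step F : (forall i, admissible (F i)) -> admissible (step F).
Proof.
move=> aF; have ww := child_weightP aF; split.
- by move=> s t st; rewrite ler_wpM2r ?invr_ge0 ?(ltW (normalizer_gt0 aF))// primitive_homo.
- by move=> z; rewrite divr_ge0 ?(ltW (normalizer_gt0 aF))// primitive_ge0.
- by move=> z z1; rewrite /step primitive_ge1// divff// gt_eqF// normalizer_gt0.
- rewrite (_ : m = step (fun _ _ => 1)); last by apply/funext => z; rewrite step_cst1.
  apply: step_anti => // [_|i]; first exact: admissible_cst1.
  by apply: rh_le_cst1; exact: adm_homo.
Qed.

Lemma step_le0 F z : (forall i, admissible (F i)) -> z <= 0 -> step F z = 0.
Proof. by move=> aF z0; rewrite /step primitive_le0 ?mul0r//; exact: child_weightP. Qed.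

Lemma step_lipschitz F y z : (forall i, admissible (F i)) -> y <= z ->
  step F z - step F y <= K * 2 ^+ D.+1 * (z - y).
Proof.
move=> aF yz; have ww := child_weightP aF; have Z0 := normalizer_gt0 aF.
rewrite /step -mulrBl ler_pdivrMr//.
apply: le_trans (primitive_increment_le ww yz) _.
apply: (@le_trans _ _ (K * (z - y))).
  apply: le_trans (spin_cdf_lipschitz mu_spin yz).
  by apply: ler_piMl; [rewrite subr_ge0 spin_cdf_homo|exact: weight_le1].
have Kz : 0 <= K * (z - y) by rewrite mulr_ge0 ?lipschitz_const_ge0 ?subr_ge0.
have : 1 <= 2 ^+ D.+1 * P (child_weight F) 1.
  by rewrite mulrC -ler_pdivrMr ?exprn_gt0// div1r -exprVn normalizer_ge.
move: (2 ^+ D.+1) (P (child_weight F) 1) => a b ab.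
have := ler_wpM2l Kz ab; rewrite mulr1; lra.
Qed.

(** The numerators are ordered like the integrands, so only the normalizers can
    make the step of the smaller family exceed the step of the larger one. *)
Lemma step_diff_le F G z : (forall i, admissible (F i)) -> (forall i, admissible (G i)) ->
  (forall i t, F i t <= G i t) ->
  step F z - step G z <=
  2 ^+ D.+1 * (P (child_weight G) 1 - P (child_weight F) 1).
Proof.
move=> aF aG FG; have wF := child_weightP aF; have wG := child_weightP aG.
have ZF := normalizer_gt0 aF; have ZG := normalizer_gt0 aG.
have wFG t : child_weight F t <= child_weight G t.
  by apply: ler_prod => i _; rewrite FG andbT; exact: adm_ge0.
have le z' : P (child_weight F) z' <= P (child_weight G) z'.
  by apply: le_primitive => [||t _ _]; [exact: weight_integrable|exact: weight_integrable|exact: wFG].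
have leZ := le 1.
have Z1 : 1 <= 2 ^+ D.+1 * P (child_weight F) 1.
  by rewrite mulrC -ler_pdivrMr ?exprn_gt0// div1r -exprVn normalizer_ge.
have G1 : step G z <= 1 by apply: admissible_le1; exact: admissible_step.
have G0 : 0 <= step G z by apply: adm_ge0; exact: admissible_step.
have EG : step G z * P (child_weight G) 1 = P (child_weight G) z.
  by rewrite /step mulfVK// gt_eqF.
have EF : step F z * P (child_weight F) 1 = P (child_weight F) z.
  by rewrite /step mulfVK// gt_eqF.
have := le z; rewrite -EF -EG => h.
rewrite -(ler_pM2r ZF).
have h1 : (step F z - step G z) * P (child_weight F) 1 <=
  P (child_weight G) 1 - P (child_weight F) 1.
  have : 0 <= (1 - step G z) * (P (child_weight G) 1 - P (child_weight F) 1).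
    by rewrite mulr_ge0 ?subr_ge0.
  lra.
apply: le_trans h1 _.
rewrite mulrAC ler_peMl// subr_ge0//.
Qed.

End SymmetricSpin.

(** * Contraction of the normalizers *)

Section Contraction.
Context {R : realType} (mu : {measure set (measurableTypeR R) -> \bar R}).
Context (D : nat) (K : R).
Hypothesis mu_spin : symmetric_spin mu K.

Local Notation m := (spin_cdf mu).
Local Notation P := (primitive mu).

Definition regular_step (A : R -> R) : R -> R := step mu (fun _ : 'I_D => A).

Definition regular_weight (A : R -> R) : R -> R := child_weight (fun _ : 'I_D => A).

Definition normalizer (A : R -> R) : R := P (regular_weight A) 1.

Lemma regular_weightE A t : regular_weight A t = A (1 - t) ^+ D.
Proof. by rewrite /regular_weight /child_weight prodr_const card_ord. Qed.

Lemma regular_weightP A : admissible mu A -> weight (regular_weight A).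
Proof. by move=> aA; exact: (child_weightP (fun _ => aA)). Qed.

Lemma admissible_regular_step A : admissible mu A -> admissible mu (regular_step A).
Proof. by move=> aA; exact: (admissible_step mu_spin). Qed.

(** [Psi] is the conserved quantity minus the bound for its increase; its
    increments are nonpositive up to a quadratic error, which comes from freezing
    the integrands at the endpoints of [[y, z]]. *)
Lemma normalizer_contraction A : admissible mu A ->
  let B := regular_step A in let C := regular_step B in
  (forall t, C t <= A t) ->
  normalizer A - normalizer B <= D.+1%:R * (normalizer A - normalizer C).
Proof.
move=> aA B C CA.
have aB : admissible mu B by exact: admissible_regular_step.
have aC : admissible mu C by exact: admissible_regular_step.
have wA := regular_weightP aA; have wB := regular_weightP aB.
have wC := regular_weightP aC.
have iA := weight_integrable mu_spin wA; have iC := weight_integrable mu_spin wC.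
have K0 := lipschitz_const_ge0 mu_spin.
set ZA := normalizer A; set ZB := normalizer B; set ZC := normalizer C.
have ZA0 : 0 < ZA by exact: (normalizer_gt0 mu_spin).
have ZB0 : 0 < ZB by exact: (normalizer_gt0 mu_spin).
have BE z : ZA * B z = P (regular_weight A) z.
  by rewrite mulrC /B /regular_step /step mulfVK// gt_eqF.
have CE z : ZB * C z = P (regular_weight B) z.
  by rewrite mulrC /C /regular_step /step mulfVK// gt_eqF.
pose Psi z := ZA * B z ^+ D.+1 + ZB * C (1 - z) ^+ D.+1
  - D.+1%:R * (P (regular_weight A) z - P (regular_weight C) z).
have B0 : B 0 = 0 by exact: (step_le0 mu_spin).
have C0 : C 0 = 0 by exact: (step_le0 mu_spin).
have Psi0 : Psi 0 = ZB.
  rewrite /Psi B0 subr0 (adm_ge1 aC)// expr0n/= mulr0 expr1n mulr1 add0r.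
  by rewrite !(primitive_le0 mu_spin)// subrr mulr0 subr0.
have Psi1 : Psi 1 = ZA - D.+1%:R * (ZA - ZC).
  by rewrite /Psi subrr C0 (adm_ge1 aB)// expr0n/= mulr0 expr1n mulr1 addr0.
suff : Psi 1 <= Psi 0 by rewrite Psi0 Psi1; lra.
apply: (@quadratic_increment_le _ _ (D.+1%:R * (D%:R * (2 * (K * 2 ^+ D.+1)) * K))).
move=> y z y0 yz z1.
have zy1 : 1 - z <= 1 - y by lra.
have pq : B y <= B z by exact: (adm_homo aB).
have rs : C (1 - z) <= C (1 - y) by exact: (adm_homo aC).
have dm0 : 0 <= m z - m y by rewrite subr_ge0; exact: (spin_cdf_homo mu_spin).
have dmK : m z - m y <= K * (z - y) by exact: (spin_cdf_lipschitz mu_spin).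
have dmE : m (1 - y) - m (1 - z) = m z - m y.
  by rewrite !(spin_cdf_sym mu_spin)//; lra.
have Lp : B z - B y <= K * 2 ^+ D.+1 * (z - y) by exact: (step_lipschitz mu_spin).
have Ls : C (1 - y) - C (1 - z) <= K * 2 ^+ D.+1 * (z - y).
  apply: le_trans (step_lipschitz mu_spin _ zy1) _ => //; lra.
have al : ZA * (B z - B y) = P (regular_weight A) z - P (regular_weight A) y.
  by rewrite mulrBr !BE.
have al1 : ZA * (B z - B y) <= m z - m y.
  rewrite al; apply: le_trans (primitive_increment_le mu_spin wA yz) _.
  by apply: ler_piMl => //; exact: weight_le1.
have be : (B y) ^+ D * (m z - m y) <= ZB * (C (1 - y) - C (1 - z)).
  have := primitive_increment_ge mu_spin wB zy1.
  by rewrite regular_weightE [ZB * _]mulrBr !CE dmE opprB addrC subrK.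
have ga : P (regular_weight C) z - P (regular_weight C) y <= C (1 - y) ^+ D * (m z - m y).
  by have := primitive_increment_le mu_spin wC yz; rewrite regular_weightE.
have ag : P (regular_weight C) z - P (regular_weight C) y <= ZA * (B z - B y).
  rewrite al; apply: le_primitive_increment => // t _ _.
  by rewrite !regular_weightE lerXn2r ?nnegrE ?(adm_ge0 aA) ?(adm_ge0 aC).
have p0 := adm_ge0 aB y; have r0 := adm_ge0 aC (1 - z).
have q1 := admissible_le1 z aB; have s1 := admissible_le1 (1 - y) aC.
have UB := ler_wpM2l (ltW ZA0) (subrX_le D p0 pq).
have LC := ler_wpM2l (ltW ZB0) (subrX_ge D r0 rs).
have dp := subrX_le_nat D p0 pq q1; have dr := subrX_le_nat D r0 rs s1.
have pD0 : 0 <= B y ^+ D by rewrite exprn_ge0.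
have rD0 : 0 <= C (1 - z) ^+ D by rewrite exprn_ge0.
have pD1 : B y ^+ D <= 1 by rewrite exprn_ile1// (le_trans pq).
have n0 : 0 <= D.+1%:R :> R by [].
have pqD : B y ^+ D <= B z ^+ D by rewrite lerXn2r// nnegrE// (le_trans p0).
have rsD : C (1 - z) ^+ D <= C (1 - y) ^+ D by rewrite lerXn2r// nnegrE// (le_trans r0).
(* With a and g the increments of the primitives of the weights of A and C, the
   first term is at most B y ^ D * a and the second at least B y ^ D * g, up to
   Lipschitz errors; and B y ^ D * (a - g) <= a - g. *)
have key : B z ^+ D * (ZA * (B z - B y))
   - C (1 - z) ^+ D * (ZB * (C (1 - y) - C (1 - z)))
   - (ZA * (B z - B y) - (P (regular_weight C) z - P (regular_weight C) y))
   <= (D%:R * (2 * (K * 2 ^+ D.+1)) * K) * (z - y) ^+ 2.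
  move: (ZA * (B z - B y)) al1 ag {al UB} => a al1 ag.
  move: (ZB * (C (1 - y) - C (1 - z))) be {LC} => b be.
  move: (P (regular_weight C) z - P (regular_weight C) y) ga ag => g ga ag.
  have h1 : (B z ^+ D - B y ^+ D) * a <= (B z ^+ D - B y ^+ D) * (m z - m y).
    by rewrite ler_wpM2l ?subr_ge0.
  have h2 := ler_wpM2l rD0 be.
  have h3 : B y ^+ D * (a - C (1 - y) ^+ D * (m z - m y)) <= B y ^+ D * (a - g).
    by rewrite ler_wpM2l// lerD2l lerN2.
  have h4 : B y ^+ D * (a - g) <= a - g by rewrite ler_piMl ?subr_ge0.
  have h5 : B y ^+ D * ((C (1 - y) ^+ D - C (1 - z) ^+ D) * (m z - m y)) <=
      (C (1 - y) ^+ D - C (1 - z) ^+ D) * (m z - m y).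
    by rewrite ler_piMl// mulr_ge0// subr_ge0.
  have h6 : (B z ^+ D - B y ^+ D + (C (1 - y) ^+ D - C (1 - z) ^+ D)) * (m z - m y)
      <= (D%:R * (2 * (K * 2 ^+ D.+1)) * (z - y)) * (K * (z - y)).
    apply: ler_pM => //; first by rewrite addr_ge0 ?subr_ge0.
    have D0 : 0 <= D%:R :> R by [].
    have := ler_wpM2l D0 Lp; have := ler_wpM2l D0 Ls; lra.
  have -> : D%:R * (2 * (K * 2 ^+ D.+1)) * K * (z - y) ^+ 2 =
    (D%:R * (2 * (K * 2 ^+ D.+1)) * (z - y)) * (K * (z - y)) by ring.
  lra.
have := ler_wpM2l n0 key; have := congr1 ( *%R D.+1%:R) al.
rewrite /Psi {key}; move: UB LC.
move: (D%:R * _ * K) (D.+1%:R) (B z ^+ D.+1) (B y ^+ D.+1) => k n u v.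
move: (C (1 - y) ^+ D.+1) (C (1 - z) ^+ D.+1) (B z ^+ D) => u' v' bz.
move: (C (1 - z) ^+ D) (z - y) => cz zy.
lra.
Qed.

End Contraction.

(** * The extremal sequence and its limit *)

Section Extremal.
Context {R : realType} (mu : {measure set (measurableTypeR R) -> \bar R}).
Context (D : nat) (K : R).
Hypothesis mu_spin : symmetric_spin mu K.

Fixpoint extremal (n : nat) : R -> R :=
  if n is k.+1 then regular_step mu D (extremal k) else fun=> 1.

Lemma admissible_extremal n : admissible mu (extremal n).
Proof.
elim: n => [|n IH]; first exact: (admissible_cst1 mu_spin).
exact: (admissible_regular_step D mu_spin).
Qed.

(** Each step swaps the two sides; the boolean is the parity of the depth. *)
Definition rh_le_alt (b : bool) (F G : R -> R) := if b then rh_le G F else rh_le F G.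

Lemma step_alt b (F G : 'I_D -> R -> R) :
  (forall i, admissible mu (F i)) -> (forall i, admissible mu (G i)) ->
  (forall i, rh_le_alt b (F i) (G i)) -> rh_le_alt (~~ b) (step mu F) (step mu G).
Proof. by case: b => aF aG FG; apply: (step_anti mu_spin). Qed.

Lemma extremal_alt n p : rh_le_alt (odd n) (extremal n) (extremal (p + n)).
Proof.
elim: n => [|n IH]; first by apply: rh_le_cst1; exact: adm_homo (admissible_extremal _).
by rewrite addnS /=; apply: step_alt => i //; exact: (admissible_extremal _).
Qed.

Lemma extremal_even_ge k n z : (k.*2 <= n)%N -> extremal n z <= extremal k.*2 z.
Proof.
move=> kn; have := extremal_alt k.*2 (n - k.*2).
rewrite odd_double subnK//= => h.
exact: rh_le_pointwise z (admissible_extremal _) (admissible_extremal _) h.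
Qed.

Lemma extremal_odd_le k n z : (k.*2.+1 <= n)%N ->
  extremal k.*2.+1 z <= extremal n z.
Proof.
move=> kn; have := extremal_alt k.*2.+1 (n - k.*2.+1).
rewrite subnK// {1}[odd _]/= odd_double => h.
exact: rh_le_pointwise z (admissible_extremal _) (admissible_extremal _) h.
Qed.

Lemma normalizer_le A B : admissible mu A -> admissible mu B ->
  (forall t, A t <= B t) -> normalizer mu D A <= normalizer mu D B.
Proof.
move=> aA aB AB; apply: le_primitive => [||t _ _].
- by apply: (weight_integrable mu_spin); exact: regular_weightP aA.
- by apply: (weight_integrable mu_spin); exact: regular_weightP aB.
- rewrite !regular_weightE lerXn2r ?nnegrE//; [exact: adm_ge0 aA _|exact: adm_ge0 aB _].
Qed.

Lemma normalizer_le1 A : admissible mu A -> normalizer mu D A <= 1.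
Proof.
move=> aA; have wA := regular_weightP D aA.
have := primitive_increment_le mu_spin wA ler01.
rewrite (primitive_le0 mu_spin wA (lexx 0)) subr0 (spin_cdf_1 mu_spin).
by rewrite (spin_cdf_0 mu_spin) subr0 mulr1 => /le_trans; apply; exact: weight_le1.
Qed.

Definition rate : R := D%:R / D.+1%:R.

Lemma rate_ge0 : 0 <= rate. Proof. by rewrite divr_ge0. Qed.

Lemma rate_lt1 : rate < 1. Proof. by rewrite ltr_pdivrMr// mul1r ltr_nat. Qed.

(** Since [Z_(2k+1) <= Z_(2k+3)], the next gap is at most
    [Z_(2k+2) - Z_(2k+1)], that is the present gap minus [Z_(2k) - Z_(2k+2)], and
    [normalizer_contraction] says that a fraction [1 / (D+1)] of it is lost. *)
Lemma normalizer_gap k :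
  normalizer mu D (extremal k.*2) - normalizer mu D (extremal k.*2.+1) <= rate ^+ k.
Proof.
elim: k => [|k IH].
  have := normalizer_le1 (admissible_extremal 0).
  have := normalizer_gt0 mu_spin (fun _ : 'I_D => admissible_extremal 1).
  by rewrite expr0 -/(regular_weight D _) -/(normalizer mu D _) => /=; lra.
have := @normalizer_contraction _ mu D K mu_spin _ (admissible_extremal k.*2).
move=> /(_ (fun t => extremal_even_ge t (leqW (leqnSn k.*2)))) /=.
have := @normalizer_le _ _ (admissible_extremal k.*2.+1) (admissible_extremal k.*2.+3)
  (fun t => extremal_odd_le t (leqW (leqnSn k.*2.+1))).
rewrite /= -/(extremal k.*2.+1).
move: IH; rewrite exprS /= /rate.
set r := (D%:R / D.+1%:R) ^+ k.
set z0 := normalizer _ _ (extremal _); set z1 := normalizer _ _ (regular_step _ _ (extremal _)).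
set z2 := normalizer _ _ (regular_step _ _ (regular_step _ _ (extremal _))).
set z3 := normalizer _ _ (regular_step _ _ (regular_step _ _ (regular_step _ _ (extremal _)))).
move=> IH h13 hc.
have D0 : 0 <= D%:R :> R by [].
have n0 : 0 < D.+1%:R :> R by [].
rewrite -(ler_pM2l n0) mulrA mulrCA divff ?gt_eqF// mulr1.
have IH' := ler_wpM2l D0 IH; have h13' := ler_wpM2l (ltW n0) h13.
have nE : D.+1%:R = D%:R + 1 :> R by rewrite mulrSr.
rewrite nE in hc h13' *; lra.
Qed.

Lemma extremal_gap k z :
  extremal k.*2.+2 z - extremal k.*2.+1 z <= 2 ^+ D.+1 * rate ^+ k.
Proof.
have aE n : forall i : 'I_D, admissible mu (extremal n) by move=> _; exact: admissible_extremal.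
apply: le_trans (step_diff_le mu_spin z (aE k.*2.+1) (aE k.*2) _) _.
  by move=> _ t; exact: extremal_even_ge.
by rewrite ler_wpM2l ?exprn_ge0//; exact: normalizer_gap.
Qed.

Definition limit_cdf (z : R) : R := inf (range (fun k => extremal k.*2 z)).

Lemma limit_cdf_le k z : limit_cdf z <= extremal k.*2 z.
Proof.
apply: ge_inf; last by exists k.
by exists 0 => _ [j _ <-]; exact: adm_ge0 (admissible_extremal _) _.
Qed.

Lemma limit_cdf_ge k z : extremal k.*2.+1 z <= limit_cdf z.
Proof.
apply: lb_le_inf; first by exists (extremal 0.*2 z), 0%N.
move=> _ [j _ <-].
apply: (@le_trans _ _ (extremal (maxn j k).*2.+1 z)).
  by apply: extremal_odd_le; rewrite ltnS leq_double leq_maxr.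
by apply: extremal_even_ge; rewrite ltnW// ltnS leq_double leq_maxl.
Qed.

Lemma rate_small (c e : R) : 0 < e -> exists k, c * rate ^+ k <= e.
Proof.
move=> e0.
have : (fun k => c * rate ^+ k) @ \oo --> c * 0.
  apply: cvgMr; apply: cvg_expr; rewrite ger0_norm ?rate_ge0//; exact: rate_lt1.
rewrite mulr0 => /cvgrPdist_le/(_ _ e0)[k _ /(_ k)] /= /(_ (leqnn k)).
by rewrite sub0r normrN => h; exists k; apply: le_trans h; exact: ler_norm.
Qed.

Lemma limit_cdf_homo : {homo limit_cdf : y z / y <= z}.
Proof.
move=> y z yz; apply: lb_le_inf; first by exists (extremal 0.*2 z), 0%N.
move=> _ [j _ <-]; apply: le_trans (limit_cdf_le j y) _.
exact: adm_homo (admissible_extremal _) _ _ yz.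
Qed.

Lemma limit_cdf_le0 z : z <= 0 -> limit_cdf z = 0.
Proof.
move=> z0; apply/eqP; rewrite eq_le; apply/andP; split.
  apply: le_trans (limit_cdf_le 1 z) _.
  by rewrite [extremal _ z](step_le0 mu_spin (fun _ => admissible_extremal 1) z0).
by apply: le_trans (limit_cdf_ge 0 z); exact: adm_ge0 (admissible_extremal _) _.
Qed.

Lemma limit_cdf_ge1 z : 1 <= z -> limit_cdf z = 1.
Proof.
move=> z1; apply/eqP; rewrite eq_le; apply/andP; split.
  by apply: le_trans (limit_cdf_le 0 z) _.
apply: le_trans (limit_cdf_ge 0 z).
by rewrite (adm_ge1 (admissible_extremal _) z1).
Qed.

(** Bound the limit above at [z] by an even term and below at [y] by the odd term
    before it.  Replacing the even term by the odd one costs the gap, which is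
    arbitrarily small, and the odd term is Lipschitz. *)
Lemma limit_cdf_lipschitz y z : y <= z ->
  limit_cdf z - limit_cdf y <= K * 2 ^+ D.+1 * (z - y).
Proof.
move=> yz; apply/ler_addgt0Pr => e e0.
have [k hk] := rate_small (2 ^+ D.+1) e0.
have := limit_cdf_le k.+1 z; have := limit_cdf_ge k y; have := extremal_gap k z.
have := step_lipschitz mu_spin (fun _ : 'I_D => admissible_extremal k.*2) yz.
rewrite -/(regular_step mu D _) -/(extremal k.*2.+1) -/(extremal k.+1.*2).
rewrite doubleS; move: hk.
move: (extremal _ z) (extremal k.*2.+1 z) (extremal k.*2.+1 y) (_ * rate ^+ k).
move: (K * _ * _) => *; lra.
Qed.

Lemma continuous_limit_cdf : continuous limit_cdf.
Proof.
have C0 : 0 <= K * 2 ^+ D.+1 by rewrite mulr_ge0 ?(lipschitz_const_ge0 mu_spin).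
have lip y z : `|limit_cdf y - limit_cdf z| <= K * 2 ^+ D.+1 * `|y - z|.
  wlog yz : y z / y <= z.
    move=> H; have [/H//|/ltW/H] := leP y z.
    by rewrite distrC [`|z - y|]distrC.
  rewrite distrC [`|y - z|]distrC !ger0_norm ?subr_ge0//; last exact: limit_cdf_homo.
  exact: limit_cdf_lipschitz.
move=> x; apply/cvgrPdist_le => e e0.
set C := K * 2 ^+ D.+1 in C0 lip.
have d0 : 0 < e / (C + 1) by rewrite divr_gt0// ltr_wpDl.
near=> t.
apply: le_trans (lip x t) _.
have h : `|x - t| <= e / (C + 1).
  by near: t; apply: (@cvgr_dist_le _ _ _ (nbhs x) _ id x) => //.
apply: le_trans (ler_wpM2l C0 h) _.
rewrite mulrCA ler_piMr ?(ltW e0)// ler_pdivrMr ?mul1r ?lerDl// ltr_wpDl//.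
Unshelve. all: by end_near.
Qed.

End Extremal.

(** * Arbitrary boundary conditions *)

Section RootCdfBounds.
Context {R : realType} (mu : {measure set (measurableTypeR R) -> \bar R}).
Context (D : nat) (K : R).
Hypothesis mu_spin : symmetric_spin mu K.

Local Notation m := (spin_cdf mu).

(** Conditioning on leaf spins truncates the free spin at [1 - max_spin x]: the
    ratio of the truncated CDF to [spin_cdf] is constant up to this point and
    decreases beyond it. *)
Lemma root_cdf1_bounds (x : leaf D 1 -> R) :
  admissible mu (root_cdf1 mu x) /\ rh_le (root_cdf1 mu x) (extremal mu D 1).
Proof.
have -> : extremal mu D 1 = m.
  by apply/funext => z; exact: (step_cst1 D mu_spin).
have x0 : 0 <= max_spin x by exact: bigmax_ge_id.
rewrite /root_cdf1; have [x1|x1] := ltP (max_spin x) 1; last first.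
  have a1 := admissible_cst1 mu_spin; split => //; exact: adm_rh_le a1.
set b := 1 - max_spin x.
have b0 : 0 < b by rewrite subr_gt0.
have mb0 := spin_cdf_gt0 mu_spin b0.
have rh : rh_le (fun z => m (Num.min z b) / m b) m.
  move=> s t st; rewrite mulrAC [leRHS]mulrAC ler_wpM2r ?invr_ge0 ?(ltW mb0)//.
  have [tb|bt] := leP t b; first by rewrite (min_idPl (le_trans st tb)) mulrC.
  have [sb|bs] := leP s b.
    by rewrite mulrC ler_wpM2l ?(spin_cdf_ge0)// (spin_cdf_homo mu_spin)// ltW.
  by rewrite ler_wpM2l ?(spin_cdf_ge0)// (spin_cdf_homo mu_spin).
split => //; split => //.
- move=> s t st; rewrite ler_wpM2r ?invr_ge0 ?(ltW mb0)// (spin_cdf_homo mu_spin)//.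
  by rewrite le_min !ge_min st lexx orbT.
- move=> z z1; have bz : b <= z by rewrite (le_trans _ z1)// lerBlDr lerDl.
  by rewrite (min_idPr bz) divff// gt_eqF.
Qed.

Lemma root_cdf_bounds k (x : leaf D k.+1 -> R) :
  [/\ admissible mu (@root_cdf_succ R D mu k x),
      rh_le_alt (odd k) (extremal mu D k) (@root_cdf_succ R D mu k x) &
      rh_le_alt (odd k) (@root_cdf_succ R D mu k x) (extremal mu D k.+1)].
Proof.
elim: k x => [|k IH] x.
  have [aF Fm] := root_cdf1_bounds x; split => //.
  by apply: rh_le_cst1; exact: adm_homo aF.
have aF i : admissible mu (@root_cdf_succ R D mu k (sub_boundary x i)).
  by have [] := IH (sub_boundary x i).
have aE n : forall i : 'I_D, admissible mu (extremal mu D n).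
  by move=> _; exact: (admissible_extremal D mu_spin).
split.
- exact: (admissible_step mu_spin aF).
- by apply: (step_alt mu_spin (aE k) aF) => i; have [] := IH (sub_boundary x i).
- by apply: (step_alt mu_spin aF (aE k.+1)) => i; have [] := IH (sub_boundary x i).
Qed.

Lemma root_cdf_dist k j (x : leaf D j.+1 -> R) z : (k.*2.+1 <= j)%N ->
  `|@root_cdf_succ R D mu j x z - limit_cdf mu D z| <= 2 ^+ D.+1 * rate D ^+ k.
Proof.
move=> kj; have [aF lo hi] := root_cdf_bounds x.
have aE := admissible_extremal D mu_spin.
have bnd n : (k.*2.+1 <= n)%N ->
    extremal mu D k.*2.+1 z <= extremal mu D n z <= extremal mu D k.*2.+2 z.
  move=> kn; rewrite (extremal_odd_le D mu_spin)//=.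
  move: kn; rewrite leq_eqVlt => /orP[/eqP<-|kn].
    exact: (extremal_odd_le D mu_spin z (leqnSn k.*2.+1)).
  by apply: (extremal_even_ge D mu_spin (k := k.+1)); rewrite doubleS.
have /andP[l1 u1] := bnd _ kj; have /andP[l2 u2] := bnd _ (leqW kj).
have gap := extremal_gap D mu_spin k z.
have Glo := limit_cdf_ge D mu_spin k z.
have Ghi : limit_cdf mu D z <= extremal mu D k.*2.+2 z by exact: (limit_cdf_le D mu_spin k.+1).
have [Flo Fhi] : extremal mu D k.*2.+1 z <= @root_cdf_succ R D mu j x z /\
                 @root_cdf_succ R D mu j x z <= extremal mu D k.*2.+2 z.
  move: lo hi; rewrite /rh_le_alt; case: odd => lo hi.
  - have h1 := rh_le_pointwise z aF (aE _) lo.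
    have h2 := rh_le_pointwise z (aE _) aF hi.
    by split; [apply: le_trans h1|apply: le_trans u2].
  - have h1 := rh_le_pointwise z (aE _) aF lo.
    have h2 := rh_le_pointwise z aF (aE _) hi.
    by split; [apply: le_trans h2|apply: le_trans u1].
rewrite ler_norml; lra.
Qed.

End RootCdfBounds.

(** * The epsilon-continuous spin measure *)

Lemma truncation_lipschitz (R : realDomainType) (a b y z : R) : y <= z ->
  Num.max 0 (Num.min b z - a) - Num.max 0 (Num.min b y - a) <= z - y.
Proof.
move=> yz; rewrite lerBlDr ge_max; apply/andP; split.
  by rewrite addr_ge0 ?subr_ge0// le_max lexx.
apply: (@le_trans _ _ (z - y + (Num.min b y - a))).
  by case: (leP b y); case: (leP b z) => *; lra.
by rewrite lerD2l le_max lexx orbT.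
Qed.

Section FreeSpin.
Context {R : realType} (eps : R).
Hypotheses (eps_gt0 : 0 < eps) (eps_lt : eps < 1 / 2).

Local Notation leb := (@lebesgue_measure R).

Lemma free_spinE (A : set (measurableTypeR R)) : measurable A ->
  free_spin eps A =
    ((2 * eps)^-1%:E * (leb (`[0%R, eps]%classic `&` A) + leb (`[(1 - eps)%R, 1%R]%classic `&` A)))%E.
Proof.
move=> mA; rewrite /free_spin /spin_density; set k := _^-1.
have mI (i : interval R) : measurable_fun A (EFin \o (\1_[set` i] : R -> R)).
  by apply/measurable_EFinP; exact: measurable_indic.
under eq_integral do rewrite EFinM EFinD.
have I0 (i : interval R) x : (0 <= (\1_[set` i] x : R)%:E)%E by rewrite lee_fin.
rewrite ge0_integralZl//; first last.
- by rewrite lee_fin invr_ge0 mulr_ge0// ltW.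
- by move=> x _; rewrite adde_ge0.
- by apply: emeasurable_funD; exact: mI.
rewrite ge0_integralD//; [|exact: mI|exact: mI].
by rewrite !integral_indic.
Qed.

Lemma lebesgue_itvI (a b z : R) : 0 <= a ->
  leb (`[a, b]%classic `&` `[0, z]%classic) = (Num.max 0 (Num.min b z - a))%:E.
Proof.
move=> a0.
have -> : `[a, b]%classic `&` `[0, z]%classic = `[a, Num.min b z]%classic :> set R.
  apply/seteqP; split => x /=; rewrite !in_itv/= le_min.
    by move=> [/andP[-> ->] /andP[_ ->]].
  by move=> /and3P[ax -> ->]; rewrite ax (le_trans a0 ax).
rewrite lebesgue_measure_itv/= lte_fin; case: ltP => h.
  by rewrite -EFinB max_r// subr_ge0 ltW.
by rewrite max_l// subr_le0.
Qed.

Lemma free_spin_cdfE (z : R) : spin_cdf (free_spin eps) z =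
  (2 * eps)^-1 * (Num.max 0 (Num.min eps z) + Num.max 0 (Num.min 1 z - (1 - eps))).
Proof.
have e1 : 0 <= 1 - eps by move: eps_lt; lra.
by rewrite /spin_cdf [X in fine X]free_spinE// !lebesgue_itvI// subr0 -EFinD -EFinM.
Qed.

Lemma free_spin_symmetric : symmetric_spin (free_spin eps) eps^-1.
Proof.
have e0 := eps_gt0; have e1 := eps_lt.
have e2 : 0 < 2 * eps by lra.
split.
- rewrite [X in (X <= _)%E]free_spinE// !setIT !lebesgue_measure_itv/= !lte_fin eps_gt0.
  rewrite ltrBlDr ltrDl eps_gt0 -!EFinB -EFinD -EFinM lee_fin.
  by rewrite mulrC ler_pdivrMr//; lra.
- rewrite free_spin_cdfE (_ : _ + _ = 0) ?mulr0//.
  by rewrite (min_idPr (ltW e0)) (min_idPr ler01) maxxx max_l; lra.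
- move=> y z yz; rewrite !free_spin_cdfE -mulrBr mulrC ler_pdivrMr//.
  have -> : eps^-1 * (z - y) * (2 * eps) = 2 * (z - y).
    by field; rewrite gt_eqF.
  have h1 := truncation_lipschitz 0 eps yz; rewrite !subr0 in h1.
  by have := truncation_lipschitz (1 - eps) 1 yz; lra.
- move=> z z0 z1; rewrite !free_spin_cdfE.
  apply: (mulfI (lt0r_neq0 e2)); rewrite mulrBr mulr1 !mulVKf ?gt_eqF//.
  have z1' : 1 - z <= 1 by lra.
  have z0' : 0 <= 1 - z by lra.
  rewrite (min_idPr z1) (min_idPr z1') !(@max_r _ _ 0 (Num.min _ _)) ?le_min ?z0 ?z0' ?ltW//.
  case: (leP eps z); case: (leP eps (1 - z)) => *;
    by case: (leP 0 (1 - z - (1 - eps))); case: (leP 0 (z - (1 - eps))) => *; lra.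
- move=> z z0; rewrite free_spin_cdfE mulr_gt0 ?invr_gt0//.
  apply: ltr_pwDl; last by rewrite le_max lexx.
  by rewrite lt_max lt_min eps_gt0 z0 orbT.
Qed.

End FreeSpin.

(** * Convergence *)

Theorem theorem3p4 (R : realType) (D : nat) (eps : R)
    (hD : (1 <= D)%N) (heps0 : 0 < eps) (heps1 : eps < 1 / 2) :
  exists G : R -> R,
    [/\ {homo G : y z / y <= z},
        continuous G,
        (forall z, z <= 0 -> G z = 0),
        (forall z, 1 <= z -> G z = 1) &
        (fun n : nat =>
           ereal_sup [set ereal_sup [set (`|root_cdf (free_spin eps) x z - G z|)%:E
                                    | z in `[0, 1]%classic]
                     | x in @boundary R D n]) @ \oo --> (0 : \bar R)%E].
Proof.
have mu_spin := free_spin_symmetric heps0 heps1.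
exists (limit_cdf (free_spin eps) D); split.
- exact: (limit_cdf_homo D mu_spin).
- exact: (continuous_limit_cdf mu_spin).
- exact: (limit_cdf_le0 D mu_spin).
- exact: (limit_cdf_ge1 D mu_spin).
set u := (u in u @ \oo).
have u0 n : (0 <= u n)%E.
  apply: (@le_trans _ _ (ereal_sup [set (`|root_cdf (free_spin eps) (fun _ : leaf D n => 0)
      z - limit_cdf (free_spin eps) D z|)%:E | z in `[0, 1]%classic])); last first.
    by apply: ereal_sup_ubound; exists (fun=> 0) => // l; rewrite lexx ler01.
  apply: (@le_trans _ _ (`|root_cdf (free_spin eps) (fun _ : leaf D n => 0)
      0 - limit_cdf (free_spin eps) D 0|)%:E); first by rewrite lee_fin.
  by apply: ereal_sup_ubound; exists 0 => //=; rewrite in_itv/= lexx ler01.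
have uk k n : (k.*2.+2 <= n)%N -> (u n <= (2 ^+ D.+1 * rate D ^+ k)%:E)%E.
  case: n => // n kn.
  apply: ge_ereal_sup => _ [x _ <-]; apply: ge_ereal_sup => _ [z _ <-].
  by rewrite lee_fin; exact: (root_cdf_dist mu_spin).
apply/fine_cvgP; split.
  exists 2%N => // n /= n2.
  by rewrite ge0_fin_numE//; apply: le_lt_trans (uk 0%N n n2) (ltry _).
apply/cvgrPdist_le => e e0.
have [k hk] := rate_small D (2 ^+ D.+1) e0.
exists k.*2.+2 => // n /= kn; rewrite sub0r normrN ger0_norm ?fine_ge0//.
have ue : (u n <= e%:E)%E by apply: le_trans (uk k n kn) _; rewrite lee_fin.
rewrite -lee_fin fineK// ge0_fin_numE//.
exact: le_lt_trans ue (ltry _).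
Qed.
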